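(* Let $\mathcal{S}=(\mathcal{X},\mathcal{U},F)$ be a transition control system with stage cost $\mathcal{J}:\mathcal{X}\times\mathcal{U}\to\mathbb{R}_+$ and let $\Sigma=[\mathcal{X}_I,\mathcal{X}_T,\mathcal{X}_O]$ be a reach-avoid specification. Consider the system $\widetilde{\mathcal{S}}=(\widetilde{\mathcal{X}},\widetilde{\mathcal{U}},\widetilde{F})$ and its value function $\widetilde{v}$ generated (returned upon termination) by the algorithm RRT-ABS described in the context, applied to $\mathcal{S}$, $\mathcal{J}$ and $\Sigma$, and let $\widetilde{\Sigma}=[\xi_I,\xi_T,\xi_O]$ be the abstract specification used by the algorithm. Then: 1) $\widetilde{\mathcal{S}}$ is a state-feedback abstraction of $\mathcal{S}$; 2) there exists a controller $\widetilde{\mathcal{C}}$ that solves the control problem $(\widetilde{\mathcal{S}},\widetilde{\Sigma})$; 3) the controller $\mathcal{C}$ defined by $$\mathcal{C}(x)=\kappa(x),\quad \kappa=\widetilde{\mathcal{C}}(\xi^* ),\quad \xi^*=\operatorname{argmin}\{\widetilde{v}(\xi) : \xi\in\widetilde{\mathcal{X}},\ x\in\xi\}$$ solves the control problem $(\mathcal{S},\Sigma)$; 4) the function $v(x)=\min\{\widetilde{v}(\xi) : \xi\in\widetilde{\mathcal{X}},\ x\in\xi\}$ is a value function for $\mathcal{S}$ (with stage cost $\mathcal{J}$) in $\mathcal{X}_v=\bigcup_{\xi\in\widetilde{\mathcal{X}}}\xi$.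
   Context: **Systems.** A transition control system is a tuple $\mathcal{S}=(\mathcal{X},\mathcal{U},F)$ with state set $\mathcal{X}\subseteq\mathbb{R}^{n_x}$, input set $\mathcal{U}\subseteq\mathbb{R}^{n_u}$ and set-valued transition map $F:\mathcal{X}\times\mathcal{U}\to 2^{\mathcal{X}}$; the same terminology is used for abstract systems, whose states are subsets of $\mathcal{X}$ and whose inputs are functions. $\mathcal{U}(x)$ denotes the set of inputs available at $x$, i.e. those $u$ with $F(x,u)\neq\varnothing$. A trajectory of length $T\in\mathbb{N}\cup\{\infty\}$ is a pair of sequences $(\boldsymbol{x},\boldsymbol{u})\in\mathcal{X}^{[0,T[}\times\mathcal{U}^{[0,T-1[}$ with $u(k)\in\mathcal{U}(x(k))$ and $x(k+1)\in F(x(k),u(k))$ for all $k\in[0,T-1[$. The behavior $\mathcal{B}(\mathcal{S})$ is the set of trajectories of $\mathcal{S}$. **Controllers.** A (static) controller for $\mathcal{S}$ valid on $\mathcal{X}_v\subseteq\mathcal{X}$ is a map $\mathcal{C}:\mathcal{X}_v\to\mathcal{U}$ with $\mathcal{C}(x)\in\mathcal{U}(x)$ for all $x\in\mathcal{X}_v$. The controlled system $\mathcal{C}\times\mathcal{S}$ is $(\mathcal{X}_v,\mathcal{U},F_{\mathcal{C}})$ with $x'\in F_{\mathcal{C}}(x,u)\Leftrightarrow(u=\mathcal{C}(x)\wedge x'\in F(x,u))$. **Specifications.** For $\mathcal{X}_I,\mathcal{X}_T,\mathcal{X}_O\subseteq\mathcal{X}$, the reach-avoid specification $[\mathcal{X}_I,\mathcal{X}_T,\mathcal{X}_O]$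 is $$\Sigma=\{(\boldsymbol{x},\boldsymbol{u})\in(\mathcal{X}\times\mathcal{U})^\infty : x(0)\in\mathcal{X}_I\Rightarrow\exists N\in\mathbb{Z}_+:\ x(N)\in\mathcal{X}_T\wedge\forall k\in[0,N[:\ x(k)\notin\mathcal{X}_O\}.$$ A controller $\mathcal{C}$ solves $(\mathcal{S},\Sigma)$ if $\mathcal{X}_I\subseteq\mathcal{X}_v$ and $\mathcal{B}(\mathcal{C}\times\mathcal{S})\subseteq\Sigma$. For an abstract system $\widetilde{\mathcal{S}}$ with states $\widetilde{\mathcal{X}}\subseteq 2^{\mathcal{X}}$ and $\xi_I,\xi_T,\xi_O\subseteq\mathcal{X}$, the specification $\widetilde{\Sigma}=[\xi_I,\xi_T,\xi_O]$ is understood as follows: some abstract state on which the controller is valid contains $\xi_I$, and every controlled abstract trajectory starting at an abstract state containing $\xi_I$ reaches in finite time an abstract state contained in $\xi_T$, all abstract states visited before being disjoint from $\xi_O$. **Value function.** A function $v:\mathcal{X}\to\mathbb{R}$ is a value function with stage cost $\mathcal{J}(x,u)$ for $\mathcal{S}$ in $\mathcal{X}_v\subseteq\mathcal{X}$ if $v$ is bounded below on $\mathcal{X}_v$ and for all $x\in\mathcal{X}_v$ there exists $u\in\mathcal{U}(x)$ with $v(x)\ge\mathcal{J}(x,u)+\sup_{x'\in F(x,u)}v(x')$. **State-feedback abstraction.** Let $\mathscr{F}(X,U)$ denote the set of single-valued functions $X\to U$. A state-feedback abstraction of $\mathcal{S}$ is a system $\widetilde{\mathcal{S}}=(\widetilde{\mathcal{X}},\widetilde{\mathcal{U}},\widetilde{F})$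 with $\widetilde{\mathcal{X}}\subseteq 2^{\mathcal{X}}$, $\widetilde{\mathcal{U}}\subseteq\mathscr{F}(\mathcal{X},\mathcal{U})$ and, for every $\xi\in\widetilde{\mathcal{X}}$ and $\kappa\in\widetilde{\mathcal{U}}$ (available at $\xi$), $\widetilde{F}(\xi,\kappa)=\{\xi_+\}$ where $\xi_+\supseteq\{x'\in F(x,\kappa(x)) : x\in\xi\}$. **Notation.** $\operatorname{E}(c,\mathbf{P})=\{x\in\mathbb{R}^n : (x-c)^\top\mathbf{P}(x-c)\le 1\}$ for $c\in\mathbb{R}^n$ and $\mathbf{P}$ positive definite. **Subroutines.** - getAbsSpecification($\Sigma$): returns ellipsoids $\xi_I,\xi_T,\xi_O$ with $\mathcal{X}_I\subseteq\xi_I$, $\xi_T\subseteq\mathcal{X}_T$, $\mathcal{X}_O\subseteq\xi_O$. - getConState($\mathcal{X}$): returns some candidate state $c\in\mathcal{X}$. - getKClosestAbsStates($\widetilde{\mathcal{X}},\mathcal{A},K$): returns the $K$ elements of $\widetilde{\mathcal{X}}$ closest to the set $\mathcal{A}$ in Euclidean distance. - solveLocalProblem($c,\xi_+$): if feasible, returns $\xi=\operatorname{E}(c,\mathbf{P})$, a controller $\kappa$ with $F(x,\kappa(x))\subseteq\xi_+$ for all $x\in\xi$ and $\kappa(\xi)\subseteq\mathcal{U}$, and a number $\widetilde{\mathcal{J}}\ge\max_{x\in\xi}\mathcal{J}(x,\kappa(x))$. - handleObstacles($\xi,\xi_O$): for $\xi=\operatorname{E}(c,\mathbf{P})$ returns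 $\xi_s=\operatorname{E}(c,\gamma\mathbf{P})$, where $\gamma\ge1$ is the smallest value such that $\xi_s\cap\xi_O=\varnothing$. - getAbsValueFunction($\widetilde{\mathcal{S}},\xi_T$): returns a value function $\widetilde{v}$ for $\widetilde{\mathcal{S}}$ (with stage cost $\widetilde{\mathcal{J}}$) with $\widetilde{v}(\xi_T)=0$ and $\widetilde{v}>0$ on the other abstract states, computed as the shortest-path cost to $\xi_T$. - newTransition($\xi',\xi$): returns a controller $\kappa'$ mapping points of the given ellipsoid $\xi'$ into the given ellipsoid $\xi$ (i.e. $F(x,\kappa'(x))\subseteq\xi$ for all $x\in\xi'$), and an associated transition cost $\widetilde{\mathcal{J}}'$ (upper bound on the stage cost $\mathcal{J}(x,\kappa'(x))$ over $\xi'$). **Algorithm RRT-ABS.** Compute $\widetilde{\Sigma}=[\xi_I,\xi_T,\xi_O]$ by getAbsSpecification; set $\widetilde{\mathcal{X}}\leftarrow\{\xi_T\}$. While there is no $\xi\in\widetilde{\mathcal{X}}$ with $\xi_I\subseteq\xi$, do: (a) $c\leftarrow$ getConState($\mathcal{X}$); (b) $\xi_+\leftarrow$ getKClosestAbsStates($\widetilde{\mathcal{X}},\{c\},1$); (c) $\xi,\kappa,\widetilde{\mathcal{J}}\leftarrow$ solveLocalProblem($c,\xi_+$), and if infeasible return to (a); (d) $\xi_s\leftarrow$ handleObstacles($\xi,\xi_O$); (e) add $\xi_s$ to $\widetilde{\mathcal{X}}$ and $\kappa$ to $\widetilde{\mathcal{U}}$, set $\widetilde{F}(\xi_s,\kappa)=\{\xi_+\}$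 and $\widetilde{\mathcal{J}}(\xi_s,\kappa)=\widetilde{\mathcal{J}}$; (f) $\widetilde{\mathcal{S}}\leftarrow(\widetilde{\mathcal{X}},\widetilde{\mathcal{U}},\widetilde{F})$ and $\widetilde{v}\leftarrow$ getAbsValueFunction($\widetilde{\mathcal{S}},\xi_T$); (g) improvement step: for each $\xi'$ among the $K\ge1$ elements of $\widetilde{\mathcal{X}}$ closest to $\xi_s$, compute $\kappa',\widetilde{\mathcal{J}}'\leftarrow$ newTransition($\xi',\xi_s$) and, if $\widetilde{\mathcal{J}}'+\widetilde{v}(\xi_s)<\widetilde{v}(\xi')$, add $\kappa'$ to $\widetilde{\mathcal{U}}$ and set $\widetilde{F}(\xi',\kappa')=\{\xi_s\}$, $\widetilde{\mathcal{J}}(\xi',\kappa')=\widetilde{\mathcal{J}}'$. Return $\widetilde{\mathcal{S}},\widetilde{v}$.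
   Formalization: Target is terminal: controllers are valid off ξ_T, and claim 4 holds on X_v\ξ_T (on all X_v if ξ_T has zero-cost invariant inputs; false for J=1 otherwise); behaviors are maximal trajectories; claim 3 is for some C̃ from 2) and some argmin tie-break (every one if costs are positive). *)

(* Defs.v *)
From mathcomp Require Export all_boot all_order all_algebra.
From mathcomp Require Export all_classical all_reals ereal.
Set Implicit Arguments.
Unset Strict Implicit.
Unset Printing Implicit Defensive.
Import Order.TTheory GRing.Theory Num.Theory.
Local Open Scope classical_set_scope.
Local Open Scope ring_scope.

Record system (X U : Type) := System {
  states : set X;
  inputs : set U;
  trans : X -> U -> set X }.

(* [trans] is a map from [states * inputs] to subsets of [states]; its values
   elsewhere are irrelevant. *)
Definition is_system (X U : Type) (S : system X U) : Prop :=
  forall x u, states S x -> inputs S u -> trans S x u `<=` states S.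

Definition available (X U : Type) (S : system X U) (x : X) : set U :=
  [set u | inputs S u /\ trans S x u !=set0].

(* Lengths range over nat + {oo}; [None] is oo. *)
Definition lt_length (k : nat) (T : option nat) : Prop :=
  if T is Some n then (k < n)%N else True.

Definition trajectory (X U : Type) (S : system X U) (T : option nat)
    (x : nat -> X) (u : nat -> U) : Prop :=
  (forall k, lt_length k T -> states S (x k)) /\
  (forall k, lt_length k.+1 T ->
     available S (x k) (u k) /\ trans S (x k) (u k) (x k.+1)).

(* Trajectories that cannot be extended: the infinite ones and those ending in
   a blocking state.  Specifications are imposed on these; a proper prefix of a
   trajectory has not yet had the opportunity to reach the target. *)
Definition maximal_trajectory (X U : Type) (S : system X U) (T : option nat)
    (x : nat -> X) (u : nat -> U) : Prop :=
  trajectory S T x u /\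
  match T with
  | None => True
  | Some 0 => False
  | Some n.+1 => available S (x n) = set0
  end.

Definition controller (X U : Type) (S : system X U) (Xv : set X)
    (C : X -> U) : Prop :=
  Xv `<=` states S /\ forall x, Xv x -> available S x (C x).

(* The successors are not intersected with [Xv]: a trajectory leaving [Xv] is
   kept, and is blocked at its first state outside [Xv]. *)
Definition controlled (X U : Type) (S : system X U) (Xv : set X)
    (C : X -> U) : system X U :=
  System (states S) (inputs S)
    (fun x u => [set x' | Xv x /\ u = C x /\ trans S x u x']).

Definition reach_avoid (X : Type) (XI XT XO : set X) (T : option nat)
    (x : nat -> X) : Prop :=
  XI (x 0%N) -> exists N : nat,
    [/\ lt_length N T, XT (x N) & forall k, (k < N)%N -> ~ XO (x k)].

Definition controlled_behavior_sat (X U : Type) (S : system X U)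
    (XI XT XO : set X) (Xv : set X) (C : X -> U) : Prop :=
  forall T x u, Xv (x 0%N) ->
    maximal_trajectory (controlled S Xv C) T x u -> reach_avoid XI XT XO T x.

(* The target is terminal: the control task is over once it is reached, so that
   no input is required there and initial states that already are in the target
   need not belong to the domain [Xv] of the controller. *)
Definition solves (X U : Type) (S : system X U) (XI XT XO : set X)
    (Xv : set X) (C : X -> U) : Prop :=
  [/\ controller S Xv C, XI `<=` Xv `|` XT
    & controlled_behavior_sat S XI XT XO Xv C].

(* At the abstract level, only one abstract state covering [xiI] has to belong to
   the domain of the controller. *)
Definition abs_solves (X W : Type) (S : system (set X) W)
    (xiI xiT xiO : set X) (Xv : set (set X)) (C : set X -> W) : Prop :=
  [/\ controller S Xv C,
      exists xi, [/\ states S xi, Xv xi \/ xi `<=` xiT & xiI `<=` xi]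
    & controlled_behavior_sat S
        [set xi | xiI `<=` xi] [set xi | xi `<=` xiT]
        [set xi | xi `&` xiO !=set0] Xv C].

Definition value_function (R : realType) (X U : Type) (S : system X U)
    (J : X -> U -> R) (Xv : set X) (v : X -> R) : Prop :=
  [/\ Xv `<=` states S,
      has_lbound [set v x | x in Xv]
    & forall x, Xv x -> exists2 u, available S x u &
        ((J x u)%:E + ereal_sup [set (v x')%:E | x' in trans S x u]
           <= (v x)%:E)%E].

Definition feedback_maps (X U : Type) (S : system X U) : set (X -> U) :=
  [set kappa | forall x, states S x -> inputs S (kappa x)].

Definition state_feedback_abstraction (X U : Type) (S : system X U)
    (St : system (set X) (X -> U)) : Prop :=
  [/\ is_system St,
      forall xi, states St xi -> xi `<=` states S,
      inputs St `<=` feedback_maps S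
    & forall xi kappa, states St xi -> available St xi kappa ->
        exists2 xip : set X, trans St xi kappa = [set xip] &
          \bigcup_(x in xi) trans S x (kappa x) `<=` xip].

Definition posdef (R : realType) (n : nat) (P : 'M[R]_n) : Prop :=
  P^T = P /\ forall x : 'cV[R]_n, x != 0 -> 0 < (x^T *m P *m x) 0 0.

Definition ellipsoid (R : realType) (n : nat) (c : 'cV[R]_n) (P : 'M[R]_n) :
    set 'cV[R]_n :=
  [set x | ((x - c)^T *m P *m (x - c)) 0 0 <= 1].

Definition is_ellipsoid (R : realType) (n : nat) (A : set 'cV[R]_n) : Prop :=
  exists c P, posdef P /\ A = ellipsoid c P.

(* The norm of the library on matrices is the sup norm. *)
Definition euclidean_norm (R : realType) (n : nat) (x : 'cV[R]_n) : R :=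
  Num.sqrt (\sum_i x i 0 ^+ 2).

Definition set_dist (R : realType) (n : nat) (A B : set 'cV[R]_n) : R :=
  inf [set euclidean_norm (p.1 - p.2) | p in A `*` B].

(* [L] consists of [K] elements of [Xt] closest to [A], ties being broken
   arbitrarily; [L] is all of [Xt] when [Xt] has at most [K] elements. *)
Definition k_closest (R : realType) (n : nat) (Xt : set (set 'cV[R]_n))
    (A : set 'cV[R]_n) (K : nat) (L : set (set 'cV[R]_n)) : Prop :=
  [/\ L `<=` Xt,
      forall xi xi', L xi -> Xt xi' -> ~ L xi' -> set_dist xi A <= set_dist xi' A
    & (L #= `I_K)%card \/ (L = Xt /\ (Xt #<= `I_K)%card)].

(* Every subroutine of the algorithm is a relation between its arguments and the
   results it is allowed to return, so that a run is any execution in which all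
   the calls respect their specifications. *)

Definition abs_specification (R : realType) (n : nat)
    (XI XT XO xiI xiT xiO : set 'cV[R]_n) : Prop :=
  [/\ is_ellipsoid xiI, is_ellipsoid xiT & is_ellipsoid xiO] /\
  [/\ XI `<=` xiI, xiT `<=` XT & XO `<=` xiO].

(* [kappa] drives [xi] into [xip] at a cost of at most [j].  As an abstract
   input, it is an element of [feedback_maps S]; nothing else is required of its
   values outside [xi]. *)
Definition local_controller (R : realType) (X U : Type) (S : system X U)
    (J : X -> U -> R) (xi xip : set X) (kappa : X -> U) (j : R) : Prop :=
  [/\ feedback_maps S kappa,
      controller S xi kappa,
      forall x, xi x -> trans S x (kappa x) `<=` xip
    & forall x, xi x -> J x (kappa x) <= j].

Definition solve_local_problem (R : realType) (n : nat) (U : Type)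
    (S : system 'cV[R]_n U) (J : 'cV[R]_n -> U -> R)
    (c : 'cV[R]_n) (xip : set 'cV[R]_n)
    (P : 'M[R]_n) (kappa : 'cV[R]_n -> U) (j : R) : Prop :=
  posdef P /\ local_controller S J (ellipsoid c P) xip kappa j.

(* Minimality of [gamma] is not imposed: ellipsoids being closed, the infimum of
   the admissible [gamma]s is not attained as soon as it is larger than 1. *)
Definition handle_obstacles (R : realType) (n : nat) (c : 'cV[R]_n)
    (P : 'M[R]_n) (xiO : set 'cV[R]_n) (gamma : R) : Prop :=
  1 <= gamma /\ ellipsoid c (gamma *: P) `&` xiO = set0.

Inductive path_cost (R : realType) (X U : Type) (S : system X U)
    (J : X -> U -> R) (goal : X) : X -> R -> Prop :=
| path_cost_nil : path_cost S J goal goal 0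
| path_cost_cons x u x' r :
    available S x u -> trans S x u x' -> path_cost S J goal x' r ->
    path_cost S J goal x (J x u + r).

Definition abs_value_function (R : realType) (X W : Type)
    (St : system (set X) W) (Jt : set X -> W -> R) (xiT : set X)
    (vt : set X -> R) : Prop :=
  [/\ value_function St Jt (states St `\ xiT) vt,
      vt xiT = 0,
      forall xi, (states St `\ xiT) xi -> 0 < vt xi
    & forall xi, states St xi ->
        path_cost St Jt xiT xi (vt xi) /\
        forall r, path_cost St Jt xiT xi r -> vt xi <= r].

Record abs_data (R : realType) (X U : Type) := AbsData {
  abs_sys : system (set X) (X -> U);
  abs_cost : set X -> (X -> U) -> R }.

Definition initial_data (R : realType) (X U : Type) (xiT : set X) :
    abs_data R X U :=
  AbsData (System [set xiT] set0 (fun _ _ => set0)) (fun _ _ => 0).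

Definition add_transition (R : realType) (X U : Type) (d : abs_data R X U)
    (xi : set X) (kappa : X -> U) (xip : set X) (j : R) : abs_data R X U :=
  AbsData
    (System (states (abs_sys d)) (inputs (abs_sys d) `|` [set kappa])
       (fun xi0 kappa0 => if `[< xi0 = xi /\ kappa0 = kappa >] then [set xip]
                          else trans (abs_sys d) xi0 kappa0))
    (fun xi0 kappa0 => if `[< xi0 = xi /\ kappa0 = kappa >] then j
                       else abs_cost d xi0 kappa0).

Definition add_state (R : realType) (X U : Type) (d : abs_data R X U)
    (xi : set X) : abs_data R X U :=
  AbsData
    (System (states (abs_sys d) `|` [set xi]) (inputs (abs_sys d))
       (trans (abs_sys d)))
    (abs_cost d).

(* The improvement step towards [xis], for the states of a list in turn.  A call
   computing a transition from [xi'] to [xis] may fail, in which case [xi'] is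
   skipped. *)
Inductive improvement (R : realType) (X U : Type) (S : system X U)
    (J : X -> U -> R) (xis : set X) (vt : set X -> R) :
    seq (set X) -> abs_data R X U -> abs_data R X U -> Prop :=
| improvement_nil d : improvement S J xis vt [::] d d
| improvement_fail xi' l d d' :
    improvement S J xis vt l d d' -> improvement S J xis vt (xi' :: l) d d'
| improvement_step xi' kappa' j' l d d' :
    local_controller S J xi' xis kappa' j' ->
    improvement S J xis vt l
      (if j' + vt xis < vt xi' then add_transition d xi' kappa' xis j' else d)
      d' ->
    improvement S J xis vt (xi' :: l) d d'.

(* The body of the loop when the local problem is feasible (an infeasible
   attempt changes nothing): from [d], it produces [d'] and [vt].  Note that [vt]
   is computed before the improvement step. *)
Inductive iteration (R : realType) (n : nat) (U : Type)
    (S : system 'cV[R]_n U) (J : 'cV[R]_n -> U -> R)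
    (xiT xiO : set 'cV[R]_n) (K : nat) (d : abs_data R 'cV[R]_n U) :
    abs_data R 'cV[R]_n U -> (set 'cV[R]_n -> R) -> Prop :=
| Iteration c xip P kappa j gamma vt l d' :
    let xis := ellipsoid c (gamma *: P) in
    let d1 := add_transition (add_state d xis) xis kappa xip j in
    states S c ->
    k_closest (states (abs_sys d)) [set c] 1 [set xip] ->
    solve_local_problem S J c xip P kappa j ->
    handle_obstacles c P xiO gamma ->
    abs_value_function (abs_sys d1) (abs_cost d1) xiT vt ->
    uniq l -> k_closest (states (abs_sys d1)) xis K [set` l] ->
    improvement S J xis vt l d1 d' ->
    iteration S J xiT xiO K d d' vt.

Definition stopping (R : realType) (X U : Type) (xiI : set X)
    (d : abs_data R X U) : Prop :=
  exists2 xi, states (abs_sys d) xi & xiI `<=` xi.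

(* The data and value function after some number of iterations.  The value
   function is initialized as that of the initial data, which only matters when
   the body of the loop is never executed. *)
Inductive reachable (R : realType) (n : nat) (U : Type)
    (S : system 'cV[R]_n U) (J : 'cV[R]_n -> U -> R)
    (xiI xiT xiO : set 'cV[R]_n) (K : nat) :
    abs_data R 'cV[R]_n U -> (set 'cV[R]_n -> R) -> Prop :=
| reachable_init vt :
    abs_value_function (abs_sys (initial_data R U xiT))
      (abs_cost (initial_data R U xiT)) xiT vt ->
    reachable S J xiI xiT xiO K (initial_data R U xiT) vt
| reachable_iter d vt d' vt' :
    reachable S J xiI xiT xiO K d vt -> ~ stopping xiI d ->
    iteration S J xiT xiO K d d' vt' ->
    reachable S J xiI xiT xiO K d' vt'.

Definition rrt_abs_returns (R : realType) (n : nat) (U : Type)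
    (S : system 'cV[R]_n U) (J : 'cV[R]_n -> U -> R)
    (xiI xiT xiO : set 'cV[R]_n) (K : nat)
    (d : abs_data R 'cV[R]_n U) (vt : set 'cV[R]_n -> R) : Prop :=
  reachable S J xiI xiT xiO K d vt /\ stopping xiI d.

Definition abs_argmin (R : realType) (X : Type) (Xt : set (set X))
    (vt : set X -> R) (x : X) (xi : set X) : Prop :=
  [/\ Xt xi, xi x & forall xi', Xt xi' -> xi' x -> vt xi <= vt xi'].

(* [C x = Ct xi* x] for a minimizer [xi*], selected by an arbitrary
   tie-breaking rule. *)
Definition concretization (R : realType) (X U : Type) (Xt : set (set X))
    (vt : set X -> R) (Ct : set X -> (X -> U)) (Xv : set X)
    (C : X -> U) : Prop :=
  forall x, Xv x -> exists2 xi, abs_argmin Xt vt x xi & C x = Ct xi x.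

(* Main.v *)
(* Each abstract state [xi] other than [xiT] keeps a transition along which
   [vt] drops by at least the cost: the first edge of a shortest path survives
   the improvement step or has been replaced by a strictly better edge into
   [xis], and no edge of a shortest path from [xis] can have been replaced, as
   [vt] is at most [vt xis] along it.  Following such edges leads from every
   abstract state to [xiT].  As transition costs may vanish, progress is measured
   by [vt] first and by the number of remaining edges second; the finitely many
   abstract states turn this lexicographic order into a rank in [nat]. *)

Require Import Defs.
From mathcomp Require Import lra.
Set Implicit Arguments.
Unset Strict Implicit.
Import Order.TTheory GRing.Theory Num.Theory.
Local Open Scope classical_set_scope.
Local Open Scope ring_scope.

(** * Ranking functions and policies on abstract graphs *)

(** The natural number [m] strictly decreases until [tgt] is hit, so a run in [D] cannot go on
    forever; it cannot block in [D] either, since [C] provides an available input there. *)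
Lemma controlled_reaches (X U : Type) (S : system X U) (D tgt : set X)
    (C : X -> U) (m : X -> nat) :
  controller S D C ->
  (forall x x', D x -> trans S x (C x) x' -> tgt x' \/ D x' /\ (m x' < m x)%N) ->
  forall T x u, D (x 0%N) -> maximal_trajectory (controlled S D C) T x u ->
  exists N, [/\ lt_length N T, tgt (x N) & forall k, (k < N)%N -> D (x k)].
Proof.
move=> [_ availC] stepC T x u D0 [[_ traj] maxT].
have T0 : lt_length 0 T by case: T maxT {traj} => [[|n]|].
(* Induction on a strict bound [n] of the current rank, carrying along that the run has stayed in
   [D] up to time [k]. *)
suff H n k : (m (x k) < n)%N -> lt_length k T ->
    (forall i, (i <= k)%N -> D (x i)) ->
    exists N, [/\ lt_length N T, tgt (x N) & forall i, (i < N)%N -> D (x i)].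
  by apply: (H (m (x 0%N)).+1 0%N) => // i; rewrite leqn0 => /eqP ->.
elim: n k => [//|n IH] k mk kT Dk.
have Sk : lt_length k.+1 T.
  (* Were [k] the last index, maximality would make [x k] blocking, against the availability of
     [C (x k)]. *)
  case: T maxT kT {traj T0 IH} => [[|p]|] //= blocked.
  rewrite ltnS leq_eqVlt ltnS => /orP[/eqP kp|//].
  have Dxk : D (x k) by exact: Dk.
  have [inC [y xy]] := availC _ Dxk.
  have : available (controlled S D C) (x p) (C (x p)).
    by rewrite -kp; split => //; exists y.
  by rewrite blocked.
have [_ [Dxk [uk xk']]] := traj _ Sk.
rewrite uk in xk'.
case: (stepC _ _ Dxk xk') => [tgt'|[D' m']].
  by exists k.+1; split.
apply: (IH k.+1) => //; first exact: leq_trans m' mk.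
by move=> i; rewrite leq_eqVlt => /orP[/eqP -> //|]; exact: Dk.
Qed.

Inductive leads_to (T W : Type) (E : T -> W -> T -> Prop) (goal : T) :
    nat -> T -> Prop :=
| leads_to_nil : leads_to E goal 0 goal
| leads_to_cons n x w y :
    E x w y -> leads_to E goal n y -> leads_to E goal n.+1 x.

(** The rank is the least number of edges to [goal], and the policy takes the first edge of such a
    shortest path; [w0] is a default label elsewhere. *)
Lemma leads_to_policy (T W : Type) (w0 : W) (E : T -> W -> T -> Prop)
    (goal : T) (A : set T) :
  (forall x, A x -> exists n, leads_to E goal n x) ->
  exists (rk : T -> nat) (C : T -> W), forall x, A x -> x <> goal ->
    exists2 y, E x (C x) y & (rk y < rk x)%N.
Proof.
move=> AE.
have /choice[rk rkP] x : exists r, forall n, leads_to E goal n x ->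
    leads_to E goal r x /\ (r <= n)%N.
  have [ex|nex] := pselect (exists n, `[< leads_to E goal n x >]).
    exists (ex_minn ex) => n xn; case: ex_minnP => m /asboolP xm min_m.
    by split=> //; apply: min_m; exact/asboolP.
  by exists 0%N => n xn; case: nex; exists n; exact/asboolP.
have inv n x : leads_to E goal n x -> x <> goal ->
    exists w y, E x w y /\ exists2 k, n = k.+1 & leads_to E goal k y.
  by case=> [//|k z w y zy yk] _; exists w, y; split=> //; exists k.
have /choice[C CP] x : exists w, A x -> x <> goal ->
    exists2 y, E x w y & (rk y < rk x)%N.
  have [[Ax xg]|nx] := pselect (A x /\ x <> goal); last first.
    by exists w0 => Ax xg; case: nx.
  have [n /rkP[xr _]] := AE _ Ax.
  have [w [y [xy [k rkx yk]]]] := inv _ _ xr xg.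
  exists w => _ _; exists y => //.
  by rewrite rkx ltnS; exact: (rkP _ _ yk).2.
by exists rk, C.
Qed.

(** The rank of [x] is the number of elements of [A] lexicographically below [x]. If [y] is below
    [x], everything below [y] is counted for [x], and so is [y] itself, which is not below [y]. *)
Lemma finite_lex_rank (R : realType) (T : choiceType) (A : set T) (f : T -> R)
    (rk : T -> nat) :
  finite_set A ->
  exists m : T -> nat, forall x y, A y ->
    f y < f x \/ f y <= f x /\ (rk y < rk x)%N -> (m y < m x)%N.
Proof.
move=> /finite_seqP[s ->].
pose lex x z := (f z < f x) || (f z <= f x) && (rk z < rk x)%N.
exists (fun x => count (lex x) s) => x y ys lexyx.
have lexyxb : lex x y.
  by rewrite /lex; case: lexyx => [->//|[-> ->]]; rewrite orbT.
have lex_trans z : lex y z -> lex x z.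
  rewrite /lex; case: lexyx => [fyx|[fyx ryx]].
    case/orP => [fzy|/andP[fzy _]]; apply/orP; left; first exact: lt_trans fyx.
    exact: le_lt_trans fyx.
  case/orP => [fzy|/andP[fzy rzy]]; apply/orP; first by left; exact: lt_le_trans fyx.
  by right; rewrite (le_trans fzy fyx) (ltn_trans rzy ryx).
(* The predicates [pred1 y] and [lex y] are disjoint, so their counts add up. *)
have := count_predUI (pred1 y) (lex y) s.
rewrite (@eq_count _ (predI _ _) pred0) ?count_pred0 ?addn0; last first.
  by move=> z /=; case: eqP => //= ->; rewrite /lex !ltxx ltnn andbF.
move=> cE; apply: (@leq_trans (count (predU (pred1 y) (lex y)) s)).
  by rewrite cE -[ltnLHS]add0n ltn_add2r -has_count has_pred1.
by apply: sub_count => z /= /orP[/eqP ->|/lex_trans].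
Qed.

(** * Ellipsoids *)

Lemma ellipsoid_center (R : realType) n (c : 'cV[R]_n) P : ellipsoid c P c.
Proof. by rewrite /ellipsoid /= subrr mulmx0 mxE ler01. Qed.

Lemma ellipsoid_shrink (R : realType) n (c : 'cV[R]_n) P (gamma : R) :
  posdef P -> 1 <= gamma -> ellipsoid c (gamma *: P) `<=` ellipsoid c P.
Proof.
move=> [_ Ppos] g1 x; rewrite /ellipsoid /= -scalemxAr -scalemxAl mxE.
apply: le_trans; apply: ler_peMl => //.
have [->|nz] := eqVneq (x - c) 0; first by rewrite mulmx0 mxE.
exact/ltW/Ppos.
Qed.

(** * Invariants of the abstract data *)

(** Loop invariant. States are nonempty so that a transition cost, which bounds [J] on its source,
    inherits nonnegativity. Only [xiT] may meet [xiO]. *)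
Definition well_formed (R : realType) (X U : Type) (S : system X U)
    (J : X -> U -> R) (xiT xiO : set X) (d : abs_data R X U) : Prop :=
  [/\ finite_set (states (abs_sys d)), states (abs_sys d) xiT,
      forall xi, states (abs_sys d) xi ->
        [/\ xi !=set0, xi `<=` states S & xi = xiT \/ xi `&` xiO = set0],
      inputs (abs_sys d) `<=` feedback_maps S
    & forall xi kappa, trans (abs_sys d) xi kappa !=set0 ->
        [/\ states (abs_sys d) xi, inputs (abs_sys d) kappa
          & exists xip, [/\ trans (abs_sys d) xi kappa = [set xip],
              states (abs_sys d) xip
            & local_controller S J xi xip kappa (abs_cost d xi kappa)]]].

Section WellFormed.
Context (R : realType) (X U : Type) (S : system X U) (J : X -> U -> R)
  (xiT xiO : set X).
Implicit Types (d : abs_data R X U) (vt : set X -> R).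

Lemma well_formed_initial :
  xiT !=set0 -> xiT `<=` states S ->
  well_formed S J xiT xiO (initial_data R U xiT).
Proof.
move=> T0 TS; split => //=.
- by move=> _ ->; split => //; left.
- by move=> xi kappa [].
Qed.

Lemma well_formed_add_state d xi :
  xi !=set0 -> xi `<=` states S -> xi `&` xiO = set0 ->
  well_formed S J xiT xiO d -> well_formed S J xiT xiO (add_state d xi).
Proof.
move=> xi0 xiS xiO0 [fin dT dX dU dF]; split => //=.
- by rewrite finite_setU; split => //; exact: finite_set1.
- by left.
- by move=> xi' [/dX //|->]; split => //; right.
- move=> xi' kappa /dF[dxi' dkappa [xip [-> dxip loc]]]; split => //; first by left.
  by exists xip; split => //; left.
Qed.

Lemma well_formed_add_transition d xi kappa xip j :
  states (abs_sys d) xi -> states (abs_sys d) xip ->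
  local_controller S J xi xip kappa j ->
  well_formed S J xiT xiO d ->
  well_formed S J xiT xiO (add_transition d xi kappa xip j).
Proof.
move=> dxi dxip loc [fin dT dX dU dF]; split => //=.
- by move=> kappa' [/dU //|->]; case: loc.
- move=> xi' kappa'; case: asboolP => [[-> ->] _|_ /dF[? ? [xip' ?]]]; split => //.
  + by right.
  + by exists xip.
  + by left.
  + by exists xip'.
Qed.

Lemma improvement_states xis vt l d d' :
  improvement S J xis vt l d d' -> states (abs_sys d') = states (abs_sys d).
Proof. by elim=> {l d d'} // xi' kappa' j' l d d' _ _ ->; case: ifP. Qed.

Lemma well_formed_improvement xis vt l d d' :
  improvement S J xis vt l d d' ->
  states (abs_sys d) xis -> [set` l] `<=` states (abs_sys d) ->
  well_formed S J xiT xiO d -> well_formed S J xiT xiO d'.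
Proof.
elim=> {l d d'} // [xi' l d d' _ IH|xi' kappa' j' l d d' loc _ IH] dxis ld wfd.
  by apply: IH => // xi lxi; apply: ld; rewrite /= inE lxi orbT.
have dxi' : states (abs_sys d) xi' by apply: ld; rewrite /= inE eqxx.
have ld' : [set` l] `<=` states (abs_sys d).
  by move=> xi lxi; apply: ld; rewrite /= inE lxi orbT.
by case: ifP IH => _ IH; apply: IH => //; exact: well_formed_add_transition.
Qed.

(** An added input may coincide with one already present at the same state and overwrite its
    transition; the test guarding the addition then gives the strict inequality. *)
Lemma improvement_trans xis vt l d d' xi kappa :
  improvement S J xis vt l d d' -> available (abs_sys d) xi kappa ->
  available (abs_sys d') xi kappa /\
  (trans (abs_sys d') xi kappa = trans (abs_sys d) xi kappa /\
     abs_cost d' xi kappa = abs_cost d xi kappa \/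
   trans (abs_sys d') xi kappa = [set xis] /\
     abs_cost d' xi kappa + vt xis < vt xi).
Proof.
elim=> {l d d'} [d|xi' l d d' _ IH|xi' kappa' j' l d d' loc _] //.
  by move=> av; split => //; left.
case: ifP => // better IH av.
have [|av' E] := IH.
  case: av => [inp tr]; split; first by left.
  by rewrite /=; case: ifP => // _; exists xis.
split=> //; move: E => /=; case: asboolP => [[-> ->]|//].
case=> [[-> ->]|]; by right.
Qed.

Hypothesis J_ge0 : forall x u, states S x -> inputs S u -> 0 <= J x u.

Lemma abs_cost_ge0 d xi kappa :
  well_formed S J xiT xiO d -> available (abs_sys d) xi kappa ->
  0 <= abs_cost d xi kappa.
Proof.
move=> [_ _ dX _ dF] [_ /dF[dxi _ [xip [_ _ [_ [_ av] _ cost]]]]].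
have [[x xix] xiS _] := dX _ dxi.
apply: le_trans (cost _ xix); apply: J_ge0; first exact: xiS.
by have [] := av _ xix.
Qed.

(** * Descent of the value function along surviving edges *)

Definition descent d vt xi kappa xip : Prop :=
  [/\ available (abs_sys d) xi kappa,
      trans (abs_sys d) xi kappa = [set xip]
    & abs_cost d xi kappa + vt xip <= vt xi].

(** Induction along an optimal path of [d], optimality being [r <= vt xi]. The last hypothesis
    serves two uses in succession: its left side for [xis] itself, where it excludes overwritten
    edges, then its right side for all other states, which may be rerouted through [xis]. *)
Lemma path_descent d vt d' xis l xi r :
  well_formed S J xiT xiO d ->
  well_formed S J xiT xiO d' ->
  abs_value_function (abs_sys d) (abs_cost d) xiT vt ->
  improvement S J xis vt l d d' ->
  path_cost (abs_sys d) (abs_cost d) xiT xi r -> r <= vt xi ->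
  vt xi <= vt xis \/ (exists n, leads_to (descent d' vt) xiT n xis) ->
  exists n, leads_to (descent d' vt) xiT n xi.
Proof.
move=> wfd wfd' [_ _ _ vtP] imp; elim=> {xi r} [|x u x' r av xx' x'r IH] le_r low.
  by exists 0%N; left.
have [_ tr0] := av; have [_ _ _ _ dF] := wfd.
have [dx _ [xip [tr dxip _]]] := dF _ _ tr0.
move: xx' x'r IH; rewrite tr => -> {x'} xipr IH.
have [optp /(_ _ xipr) min_r] := vtP _ dxip.
have le_vt : vt x <= abs_cost d x u + vt xip.
  apply: (vtP _ dx).2; apply: path_cost_cons => //; first by rewrite tr.
  exact: optp.
have cost0 := abs_cost_ge0 wfd av.
(* The tail of an optimal path is optimal. *)
have le_r' : r <= vt xip by lra.
have [av' E] := improvement_trans imp av.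
have cost0' := abs_cost_ge0 wfd' av'.
case: E => [[tr' costE]|[tr' lt_vt]].
  have drop : abs_cost d' x u + vt xip <= vt x by rewrite costE; lra.
  have [|n xipn] := IH le_r'.
    by case: low => [low|ex]; [left; lra|right].
  by exists n.+1; apply: (leads_to_cons (w := u) _ xipn); split => //; rewrite tr'.
(* An overwriting edge gives [vt xis < vt x], its cost being nonnegative, against [low']. *)
have [low'|[n xisn]] := low; first by exfalso; lra.
by exists n.+1; apply: (leads_to_cons (w := u) _ xisn); split => //; exact: ltW.
Qed.

End WellFormed.

(** * Invariants along a run *)

Section Run.
Context (R : realType) (n : nat) (U : Type) (S : system 'cV[R]_n U)
  (J : 'cV[R]_n -> U -> R) (xiI xiT xiO : set 'cV[R]_n) (K : nat).
Hypothesis J_ge0 : forall x u, states S x -> inputs S u -> 0 <= J x u.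
Hypotheses (xiT0 : xiT !=set0) (xiT_sub : xiT `<=` states S).
Implicit Types (d : abs_data R 'cV[R]_n U) (vt : set 'cV[R]_n -> R).

Definition descending d vt : Prop :=
  [/\ well_formed S J xiT xiO d, vt xiT = 0,
      forall xi, states (abs_sys d) xi -> xi <> xiT -> 0 < vt xi
    & forall xi, states (abs_sys d) xi ->
        exists m, leads_to (descent d vt) xiT m xi].

(** Since [vt] is recomputed on [d1], only well-formedness has to be inherited from the previous
    iteration. *)
Lemma iteration_descending d d' vt :
  well_formed S J xiT xiO d -> iteration S J xiT xiO K d d' vt ->
  descending d' vt.
Proof.
move=> wfd []{vt d'} c xip P kappa j gamma vt l d' xis d1 Sc [near_sub _ _].
move=> [Ppos [kfeed [ES ctrl] into cost]] [gamma1 free] vtP _ [l_sub _ _] imp.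
have dxip : states (abs_sys d) xip by exact: near_sub.
have xis_sub := @ellipsoid_shrink _ _ c P gamma Ppos gamma1.
(* The controller computed for the full ellipsoid, with its cost bound, remains valid on the
   shrunken one. *)
have wf1 : well_formed S J xiT xiO d1.
  apply: well_formed_add_transition; [by right|by left| |].
    split => //; last by move=> x /xis_sub; exact: cost.
      split; first exact: subset_trans ES.
      by move=> x /xis_sub; exact: ctrl.
    by move=> x /xis_sub; exact: into.
  apply: well_formed_add_state => //; last exact: subset_trans ES.
  by exists c; exact: ellipsoid_center.
have wf' : well_formed S J xiT xiO d'.
  by apply: (well_formed_improvement imp) => //; right.
have [_ vt0 vt_gt0 vt_opt] := vtP.
have lead xi : states (abs_sys d1) xi ->
    vt xi <= vt xis \/ (exists m, leads_to (descent d' vt) xiT m xis) ->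
    exists m, leads_to (descent d' vt) xiT m xi.
  by move=> /vt_opt[p _]; exact: (path_descent _ wf1 wf' vtP imp p).
have xis_lead : exists m, leads_to (descent d' vt) xiT m xis.
  by apply: lead; [right|left].
split=> //.
  by move=> xi; rewrite (improvement_states imp) => dxi xiN; exact: vt_gt0.
by move=> xi; rewrite (improvement_states imp) => dxi; apply: lead => //; right.
Qed.

Lemma reachable_descending d vt :
  reachable S J xiI xiT xiO K d vt -> descending d vt.
Proof.
elim=> {d vt} [vt [_ vt0 _ _]|d vt d' vt' _ [wfd _ _ _] _ it]; last first.
  exact: iteration_descending it.
split=> //; first exact: well_formed_initial.
by move=> _ ->; exists 0%N; left.
Qed.

End Run.

(** * Controllers and value function from the rank *)

Theorem theorem1 (R : realType) (nx nu : nat)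
    (S : system 'cV[R]_nx 'cV[R]_nu) (J : 'cV[R]_nx -> 'cV[R]_nu -> R)
    (XI XT XO xiI xiT xiO : set 'cV[R]_nx) (K : nat)
    (d : abs_data R 'cV[R]_nx 'cV[R]_nu) (vt : set 'cV[R]_nx -> R)
    (S_system : is_system S)
    (J_ge0 : forall x u, states S x -> inputs S u -> 0 <= J x u)
    (XI_sub : XI `<=` states S) (XT_sub : XT `<=` states S)
    (XO_sub : XO `<=` states S)
    (K_ge1 : (1 <= K)%N)
    (abs_spec : abs_specification XI XT XO xiI xiT xiO)
    (returned : rrt_abs_returns S J xiI xiT xiO K d vt) :
  let St := abs_sys d in
  let Xt := states St in
  let Xv := \bigcup_(xi in Xt) xi in
  [/\ (* abstraction *)
      state_feedback_abstraction S St,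
      (* abstract and concrete controllers *)
      exists Ct : set 'cV[R]_nx -> ('cV[R]_nx -> 'cV[R]_nu),
        [/\ abs_solves St xiI xiT xiO (Xt `\ xiT) Ct,
            exists2 C, concretization Xt vt Ct (Xv `\` xiT) C &
              solves S XI XT XO (Xv `\` xiT) C
          & (forall xi kappa, Xt xi -> available St xi kappa ->
               0 < abs_cost d xi kappa) ->
            forall C, concretization Xt vt Ct (Xv `\` xiT) C ->
              solves S XI XT XO (Xv `\` xiT) C],
      forall x, Xv x -> exists xi, abs_argmin Xt vt x xi
    & (* value function *)
      forall v : 'cV[R]_nx -> R,
        (forall x xi, abs_argmin Xt vt x xi -> v x = vt xi) ->
        [/\ has_lbound [set v x | x in Xv],
            value_function S J (Xv `\` xiT) v
          & (forall x, xiT x -> exists2 u, available S x u &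
               J x u = 0 /\ trans S x u `<=` xiT) ->
            value_function S J Xv v]].
Proof.
move=> St Xt Xv.
have [[_ [cT [PT [_ TE]]] _] [XI_xiI xiT_XT XO_xiO]] := abs_spec.
have [run [xi0 dxi0 xiI0]] := returned.
have T0 : xiT !=set0 by exists cT; rewrite TE; exact: ellipsoid_center.
have [wfd vtT vt_gt0 lead] :=
  reachable_descending J_ge0 T0 (subset_trans xiT_XT XT_sub) run.
have [fin dT dX dU dF] := wfd.
have vt_ge0 xi : Xt xi -> 0 <= vt xi.
  move=> dxi; have [->|/eqP xiN] := eqVneq xi xiT; first by rewrite vtT.
  exact/ltW/vt_gt0.
have [rk [Ct CtP]] := leads_to_policy (fun=> 0 : 'cV[R]_nu) lead.
(* [m] ranks states by [vt] first and by remaining descent edges second. *)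
have [m mP] := finite_lex_rank vt rk fin.
have step xi : Xt xi -> xi <> xiT -> exists xip,
    [/\ Xt xip, descent d vt xi (Ct xi) xip, (m xip < m xi)%N
      & local_controller S J xi xip (Ct xi) (abs_cost d xi (Ct xi))].
  move=> dxi /(CtP _ dxi)[xip des rk_lt]; have [av tr drop] := des.
  have [_ tr0] := av; have [_ _ [xip' [tr' dxip' loc]]] := dF _ _ tr0.
  have xipE : xip' = xip.
    have : [set xip] xip' by rewrite -tr tr'.
    by [].
  rewrite xipE in dxip' loc; exists xip; split => //.
  by apply: mP => //; right; split=> //; have := abs_cost_ge0 J_ge0 wfd av; lra.
have argmin_ex x : Xv x -> exists2 xi, abs_argmin Xt vt x xi &
    forall xi', Xt xi' -> xi' x -> (m xi <= m xi')%N.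
  move=> [xi1 dxi1 xi1x].
  have ex : exists k, `[< exists2 xi, Xt xi /\ xi x & m xi = k >].
    by exists (m xi1); apply/asboolP; exists xi1.
  case: (ex_minnP ex) => k /asboolP[xi [dxi xix] <-] min_m.
  have m_le xi' : Xt xi' -> xi' x -> (m xi <= m xi')%N.
    by move=> dxi' xi'x; apply: min_m; apply/asboolP; exists xi'.
  (* A state with smaller [vt] would have smaller [m]: minimizing [m] minimizes [vt] and breaks its
     ties. *)
  exists xi => //; split => // xi' dxi' xi'x; rewrite leNgt; apply/negP => lt_vt.
  by have := m_le _ dxi' xi'x; rewrite leqNgt mP//; left.
have not_target x (xi : set 'cV[R]_nx) : ~ xiT x -> xi x -> xi <> xiT.
  by move=> xT xix xiE; rewrite xiE in xix.
(* Here [sel x] is the minimizer used at [x]. The tie-breaking rule enters only through the decrease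
   of [m (sel x)], left as a hypothesis. *)
have concrete C sel :
    (forall x, (Xv `\` xiT) x -> abs_argmin Xt vt x (sel x) /\ C x = Ct (sel x) x) ->
    (forall x x' xip, (Xv `\` xiT) x -> (Xv `\` xiT) x' ->
       descent d vt (sel x) (Ct (sel x)) xip -> (m xip < m (sel x))%N ->
       Xt xip -> xip x' -> (m (sel x') < m (sel x))%N) ->
    solves S XI XT XO (Xv `\` xiT) C.
  move=> selP mono.
  have stepC x : (Xv `\` xiT) x -> exists xip,
    [/\ Xt xip, descent d vt (sel x) (Ct (sel x)) xip, (m xip < m (sel x))%N,
       available S x (C x) & trans S x (C x) `<=` xip].
    move=> Dx; have [[dsel selx _] ->] := selP _ Dx.
    have [xip [dxip des m_lt [_ [_ av] into _]]] :=
      step _ dsel (not_target _ _ Dx.2 selx).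
    by exists xip; split => //; [exact: av|exact: into].
  have ctrl : controller S (Xv `\` xiT) C.
    split; first by move=> x [[xi /dX[_ xiS _] /xiS]].
    by move=> x /stepC[xip []].
  split => //.
    move=> x /XI_xiI /xiI0 xi0x; have [xT|xT] := pselect (xiT x).
      by right; exact: xiT_XT.
    by left; split => //; exists xi0.
  move=> T x u D0 traj _.
  have [|N [NT xN before]] :=
    controlled_reaches (tgt := xiT) (m := fun x => m (sel x)) ctrl _ D0 traj.
    move=> y y' Dy yy'; have [y'T|y'T] := pselect (xiT y'); first by left.
    have [xip [dxip des m_lt _ /(_ _ yy') xipy']] := stepC _ Dy.
    have Dy' : (Xv `\` xiT) y' by split => //; exists xip.
    by right; split => //; exact: mono Dy Dy' des m_lt dxip xipy'.
  exists N; split => //; first exact: xiT_XT.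
  (* Before the target, [x k] lies in [sel (x k)], which differs from [xiT] and hence is disjoint
     from [xiO]. *)
  move=> k /before Dk /XO_xiO xOk; have [[dsel selx _] _] := selP _ Dk.
  have [_ _ [/(not_target _ _ Dk.2 selx)//|disj]] := dX _ dsel.
  have : (sel (x k) `&` xiO) (x k) by [].
  by rewrite disj.
split.
- split.
  + by move=> xi kappa _ _ xip tr; have [|_ _ [y [tr' dy _]]] := dF xi kappa;
      [exists xip|move: tr; rewrite tr' => ->].
  + by move=> xi /dX[].
  + exact: dU.
  + move=> xi kappa _ [_ /dF[_ _ [xip [-> _ [_ _ into _]]]]].
    by exists xip => // x' [x xix]; exact: into.
- exists Ct; split.
  + have ctrl : controller St (Xt `\ xiT) Ct.
      split; first by move=> xi [].
      by move=> xi [dxi xiN]; have [xip [_ []]] := step _ dxi xiN.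
    split => //.
      exists xi0; split => //; have [->|/eqP xiN] := eqVneq xi0 xiT; first by right.
      by left.
    move=> T x u D0 traj _.
    have [|N [NT xN before]] :=
      controlled_reaches (tgt := [set xiT]) (m := m) ctrl _ D0 traj.
      move=> xi xi' [dxi xiN]; have [xip [dxip [_ -> _] m_lt _]] := step _ dxi xiN.
      by move=> ->; have [->|/eqP xipN] := eqVneq xip xiT; [left|right].
    exists N; split => //; first by rewrite xN.
    by move=> k /before[/dX[_ _ [//|disj]] xN'] []; rewrite disj.
  + have /choice[sel selP] x : exists xi, Xv x -> abs_argmin Xt vt x xi /\
        forall xi', Xt xi' -> xi' x -> (m xi <= m xi')%N.
      have [Dx|nDx] := pselect (Xv x); last by exists set0.
      by have [xi ? ?] := argmin_ex _ Dx; exists xi.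
    exists (fun x => Ct (sel x) x).
      by move=> x [/selP[? _] _]; exists (sel x).
    apply: (concrete _ sel) => [x [/selP[? _] _]//|x x' xip _ [Dx' _] _ m_lt dxip xipx'].
    (* The successor lies in [xip], and its selected state has the least [m] among those containing
       it. *)
    by apply: leq_ltn_trans m_lt; exact: (selP _ Dx').2.
  + move=> cost_gt0 C CP.
    have /choice[sel selP] x : exists xi, (Xv `\` xiT) x ->
        abs_argmin Xt vt x xi /\ C x = Ct xi x.
      have [Dx|nDx] := pselect ((Xv `\` xiT) x); last by exists set0.
      by have [xi ? ?] := CP _ Dx; exists xi.
    apply: (concrete _ sel) => // x x' xip Dx Dx' [av _ drop] _ dxip xipx'.
    (* With positive costs [vt] itself strictly drops: [vt (sel x') <= vt xip < vt (sel x)],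
       whatever the tie-breaking. *)
    have [[dsel _ _] _] := selP _ Dx; have [[dsel' _ min'] _] := selP _ Dx'.
    apply: mP => //; left; have := min' _ dxip xipx'.
    have := cost_gt0 _ _ dsel av; lra.
- by move=> x /argmin_ex[xi]; exists xi.
- move=> v vP.
  have v_le x xi : Xt xi -> xi x -> v x <= vt xi.
    move=> dxi xix; have [|xi' am _] := argmin_ex x; first by exists xi.
    by rewrite (vP _ _ am); case: am => _ _; exact.
  have v_ge0 x : Xv x -> 0 <= v x.
    by move=> /argmin_ex[xi am _]; rewrite (vP _ _ am); case: am => /vt_ge0.
  have lb : has_lbound [set v x | x in Xv].
    by exists 0 => _ [x Dx <-]; exact: v_ge0.
  have bellman x : (Xv `\` xiT) x -> exists2 u, available S x u &
      ((J x u)%:E + ereal_sup [set (v x')%:E | x' in trans S x u] <= (v x)%:E)%E.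
    move=> [Dx xT]; have [xi am _] := argmin_ex _ Dx; rewrite (vP _ _ am).
    have [dxi xix _] := am.
    have [xip [dxip [_ _ drop] _ [_ [_ ctrl] into cost]]] :=
      step _ dxi (not_target _ _ xT xix).
    exists (Ct xi x); first exact: ctrl.
    (* All successors lie in [xip], so [vt xip] bounds the supremum of [v] over them. *)
    apply: (@le_trans _ _ ((J x (Ct xi x))%:E + (vt xip)%:E)%E).
      apply: leeD => //; apply: ge_ereal_sup => _ [x' tr <-].
      by rewrite lee_fin; apply: v_le => //; exact: into tr.
    by rewrite -EFinD lee_fin; have := cost _ xix; lra.
  have Xv_sub : Xv `<=` states S by move=> x [xi /dX[_ xiS _] /xiS].
  split => //.
    split => //; first by move=> x [/Xv_sub].
    by exists 0 => _ [x [Dx _] <-]; exact: v_ge0.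
  move=> stay; split => // x Dx; have [xT|xT] := pselect (xiT x); last exact: bellman.
  have [u av [J0 into]] := stay _ xT; exists u => //.
  rewrite J0 add0e; apply: ge_ereal_sup => _ [x' tr <-]; rewrite lee_fin.
  (* Inside the target, [v x' <= vt xiT = 0 <= v x]. *)
  by apply: le_trans (v_ge0 _ Dx); rewrite -vtT; apply: v_le => //; exact: into.
Qed.
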